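(* Fix a real number $0<q<1$. The map $\rho:MW_q\to\mathrm{End}(M(\mathbb{R}^* ))$ given on generators by $$\rho(x)f=x^{-1}f,\qquad \rho(y)f=-q^{-1}\partial_{q^{-1}}f,\qquad \rho(q)f=qf\qquad (f\in M(\mathbb{R}^* ))$$ defines a representation of $MW_q$ (i.e. extends to a homomorphism of complex algebras).
   Context: The $q$-meromorphic Weyl algebra is $MW_q=\mathbb{C}\langle x,y\rangle[q]/\langle yx-qxy-x^2\rangle$, where $\mathbb{C}\langle x,y\rangle[q]$ is the free associative complex algebra in the non-commuting variables $x,y$ with an adjoined formal variable $q$ that commutes with everything. In the formulas for $\rho$, on the left $x,y,q$ are the generators of $MW_q$; on the right $x$ is the coordinate on $\mathbb{R}^*=\mathbb{R}\setminus\{0\}$ and $q$ is the fixed real number. $M(\mathbb{R}^* )$ is the complex vector space of all complex-valued functions on $\mathbb{R}^*$, and $\mathrm{End}$ denotes the algebra of its linear endomorphisms. For a real number $r>0$, $r\neq1$, $\partial_r f(x)=\dfrac{f(rx)-f(x)}{(r-1)x}$; in particular $\partial_{q^{-1}}f(x)=\dfrac{f(q^{-1}x)-f(x)}{(q^{-1}-1)x}$. *)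

(* Defs.v *)
From HB Require Import structures.
From mathcomp Require Import all_boot all_order all_algebra.
From mathcomp Require Import generic_quotient ring_quotient.
From mathcomp Require Import boolp functions reals.
From mathcomp Require Import finmap complex.
From mathcomp.multinomials Require Import monalg.

Set Implicit Arguments.
Unset Strict Implicit.
Unset Printing Implicit Defensive.
Import Order.TTheory GRing.Theory Num.Theory.
Local Open Scope ring_scope.
Local Open Scope complex_scope.
Local Open Scope quotient_scope.

Section FreeAlgebra.
Variable R : realType.

(* 'I_2 indexes the two letters: 0 is x and 1 is y. *)
Definition Cxy := {malg R[i][{fmonom 'I_2}]}.
HB.instance Definition _ := GRing.Lalgebra.on Cxy.

(* The polynomial variable 'X is q; it commutes with the coefficients, even
   though these form a non-commutative ring.  This is an alias because
   {poly Cxy} already carries a module structure over Cxy, whereas Cxyq is an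
   algebra over R[i]. *)
Definition Cxyq := {poly Cxy}.
HB.instance Definition _ := GRing.NzRing.on Cxyq.

Definition fscale (c : R[i]) (p : Cxyq) : Cxyq :=
  (c%:MP : Cxy) *: (p : {poly Cxy}).

Lemma malgC_comm (c : R[i]) (g : Cxy) : g * c%:MP = c%:MP * g.
Proof.
apply/malgP=> k; rewrite mul_malgC mcoeffZ.
rewrite (mcoeffMlw k (fsubset_refl (msupp g)) (msuppC_le c)).
have /(congr1 (mcoeff k)) -> := monalgE g.
rewrite raddf_sum mulr_sumr /=; apply: eq_bigr => k1 _.
by rewrite big_seq_fset1 mcoeffC eqxx mulm1 mcoeffU mulr1n mulrC mulrnAr.
Qed.

Fact fscaleA a b p : fscale a (fscale b p) = fscale (a * b) p.
Proof.
have E : (a * b)%:MP = a%:MP * b%:MP :> Cxy := @mpolyCM {fmonom 'I_2} R[i] a b.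
by rewrite /fscale E; exact: (@scalerA Cxy {poly Cxy}).
Qed.
Fact fscale1 : left_id 1 fscale.
Proof. by move=> p; rewrite /fscale rmorph1 scale1r. Qed.
Fact fscaleDr : right_distributive fscale +%R.
Proof. by move=> a p q; rewrite /fscale scalerDr. Qed.
Fact fscaleDl p : {morph fscale^~ p : a b / a + b}.
Proof. by move=> a b; rewrite /fscale raddfD /= scalerDl. Qed.
HB.instance Definition _ := GRing.Zmodule_isLmodule.Build R[i] Cxyq
  fscaleA fscale1 fscaleDr fscaleDl.

Fact fscaleAl (a : R[i]) (u v : Cxyq) : a *: (u * v) = a *: u * v.
Proof. exact: (@scalerAl _ {poly Cxy} a%:MP u v). Qed.
HB.instance Definition _ := GRing.Lmodule_isLalgebra.Build R[i] Cxyq fscaleAl.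

Fact fscaleAr (a : R[i]) (u v : Cxyq) : a *: (u * v) = u * (a *: v).
Proof.
rewrite -[LHS]/(a%:MP *: (u * v : {poly Cxy})).
rewrite -[a *: v]/(a%:MP *: (v : {poly Cxy})).
apply/polyP=> n; rewrite coefZ !coefM mulr_sumr; apply: eq_bigr => i _.
by rewrite coefZ !mulrA malgC_comm.
Qed.
HB.instance Definition _ := GRing.Lalgebra_isAlgebra.Build R[i] Cxyq fscaleAr.

End FreeAlgebra.

(* The generators are sealed: otherwise deciding that two of them are not
   convertible computes with finite-support functions. *)
HB.lock Definition letter (R : realType) (i : 'I_2) : Cxyq R :=
  (<< fmu i >> : Cxy R)%:P.
HB.lock Definition fq (R : realType) : Cxyq R := 'X.

Section Ideal.
Variable R : realType.
Local Notation Cxyq := (Cxyq R).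
Local Notation Cxy := (Cxy R).
Local Notation fq := (fq R).

Definition fx : Cxyq := letter R ord0.
Definition fy : Cxyq := letter R ord_max.

Definition mwrel : Cxyq := fy * fx - fq * fx * fy - fx ^+ 2.

Definition mwideal : {pred Cxyq} := fun p =>
  `[< exists s : seq (Cxyq * Cxyq), p = \sum_(u <- s) u.1 * mwrel * u.2 >].

Lemma mwideal0 : 0 \in mwideal.
Proof. by apply/asboolP; exists [::]; rewrite big_nil. Qed.

Lemma mwidealD : {in mwideal &, forall u v, u + v \in mwideal}.
Proof.
move=> u v /asboolP[s ->] /asboolP[t ->]; apply/asboolP.
by exists (s ++ t); rewrite big_cat.
Qed.

Lemma mwidealMl a u : u \in mwideal -> a * u \in mwideal.
Proof.
move=> /asboolP[s ->]; apply/asboolP; exists [seq (a * w.1, w.2) | w <- s].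
by rewrite big_map mulr_sumr; apply: eq_bigr => w _ /=; rewrite !mulrA.
Qed.

Lemma mwidealMr a u : u \in mwideal -> u * a \in mwideal.
Proof.
move=> /asboolP[s ->]; apply/asboolP; exists [seq (w.1, w.2 * a) | w <- s].
by rewrite big_map mulr_suml; apply: eq_bigr => w _ /=; rewrite !mulrA.
Qed.

Lemma mwideal_zmod_closed : zmod_closed mwideal.
Proof.
split=> [|u v uI vI]; first exact: mwideal0.
by apply: mwidealD => //; rewrite -mulN1r; apply: mwidealMl.
Qed.
HB.instance Definition _ := GRing.isZmodClosed.Build Cxyq mwideal
  mwideal_zmod_closed.

(* Evaluation at x = y = q = 0 shows that the ideal is proper. *)
Definition augm (p : Cxyq) : R[i] := 
  @mcoeff {fmonom 'I_2} R[i] (@mone {fmonom 'I_2}) (coefp 0 (p : {poly Cxy})).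

Lemma augm_letter i : augm (letter R i) = 0.
Proof.
rewrite /augm letter.unlock /coefp /= coefC eqxx mcoeffU1.
have -> : (fmu i == @mone {fmonom 'I_2}) = false; last by [].
by apply/negbTE/eqP => /(congr1 (@fdeg _)); rewrite fdegU fdeg1.
Qed.

Lemma augmM p q : augm (p * q) = augm p * augm q.
Proof. by rewrite /augm !rmorphM. Qed.

Lemma augmB p q : augm (p - q) = augm p - augm q.
Proof. by rewrite /augm !raddfB. Qed.

Lemma augm_mwrel : augm mwrel = 0.
Proof.
suff E a b c : augm a = 0 -> augm b = 0 -> augm (b * a - c * a * b - a ^+ 2) = 0.
  exact: E (augm_letter ord0) (augm_letter ord_max).
by move=> a0 b0; rewrite !augmB expr2 !augmM a0 b0 !mulr0 !subr0.
Qed.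

Lemma mwideal1 : 1 \notin mwideal.
Proof.
apply/negP => /asboolP[s] /(congr1 augm).
have -> : augm 1 = 1 by rewrite /augm !rmorph1.
rewrite /augm !raddf_sum /= big1 => [/eqP|w _]; first by rewrite oner_eq0.
by rewrite -[LHS]/(augm (w.1 * mwrel * w.2)) !augmM augm_mwrel mulr0 mul0r.
Qed.

End Ideal.

Section MeromorphicWeyl.
Variable R : realType.
Local Notation F := (Cxyq R).
Local Notation I := (@mwideal R).

Definition MWq := Quotient.quot I.
HB.instance Definition _ := GRing.Zmodule.on MWq.
HB.instance Definition _ := EqQuotient.on MWq.

Definition mwpi (p : F) : MWq := \pi_MWq p.

Lemma mwpiE (p q : F) : (mwpi p = mwpi q) <-> (p - q \in I).
Proof.
rewrite /mwpi (Quotient.idealrBE (mwideal (R:=R)) p q).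
by split=> [/eqP|/eqP].
Qed.

Lemma mwpi_repr u : mwpi (repr u) = u. Proof. exact: reprK. Qed.

Lemma mwpiD p q : mwpi (p + q) = mwpi p + mwpi q.
Proof. by rewrite /mwpi !piE. Qed.

Definition mwone : MWq := mwpi 1.
Definition mwmul (u v : MWq) : MWq := mwpi (repr u * repr v).
Definition mwscale (c : R[i]) (u : MWq) : MWq := mwpi (c *: repr u).

Lemma mwpiM p q : mwpi (p * q) = mwmul (mwpi p) (mwpi q).
Proof.
apply/mwpiE; rewrite -(subrKA (p * repr (mwpi q))) -mulrBr -mulrBl.
by apply: mwidealD; [apply: mwidealMl|apply: mwidealMr];
  apply/mwpiE; rewrite mwpi_repr.
Qed.

Lemma mwpiZ c p : mwpi (c *: p) = mwscale c (mwpi p).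
Proof.
apply/mwpiE; rewrite -scalerBr -mulr_algl; apply: mwidealMl.
by apply/mwpiE; rewrite mwpi_repr.
Qed.

Fact mwmulA : associative mwmul.
Proof.
by move=> u v w; rewrite -[u]mwpi_repr -[v]mwpi_repr -[w]mwpi_repr -!mwpiM mulrA.
Qed.
Fact mwmul1r : left_id mwone mwmul.
Proof. by move=> u; rewrite -[u]mwpi_repr -!mwpiM mul1r. Qed.
Fact mwmulr1 : right_id mwone mwmul.
Proof. by move=> u; rewrite -[u]mwpi_repr -!mwpiM mulr1. Qed.
Fact mwmulDl : left_distributive mwmul +%R.
Proof.
move=> u v w; rewrite -[u]mwpi_repr -[v]mwpi_repr -[w]mwpi_repr.
by rewrite -!(mwpiM, mwpiD) mulrDl.
Qed.
Fact mwmulDr : right_distributive mwmul +%R.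
Proof.
move=> u v w; rewrite -[u]mwpi_repr -[v]mwpi_repr -[w]mwpi_repr.
by rewrite -!(mwpiM, mwpiD) mulrDr.
Qed.
Fact mwone_neq0 : mwone != 0.
Proof.
apply/eqP => E; have : mwpi 1 = mwpi 0 by rewrite -/mwone E /mwpi !piE.
by move/mwpiE; rewrite subr0 (negbTE (mwideal1 R)).
Qed.
HB.instance Definition _ := GRing.Zmodule_isNzRing.Build MWq
  mwmulA mwmul1r mwmulr1 mwmulDl mwmulDr mwone_neq0.

Fact mwscaleA a b u : mwscale a (mwscale b u) = mwscale (a * b) u.
Proof. by rewrite -[u]mwpi_repr -!mwpiZ scalerA. Qed.
Fact mwscale1 : left_id 1 mwscale.
Proof. by move=> u; rewrite -[u]mwpi_repr -!mwpiZ scale1r. Qed.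
Fact mwscaleDr : right_distributive mwscale +%R.
Proof.
move=> a u v; rewrite -[u]mwpi_repr -[v]mwpi_repr.
by rewrite -!(mwpiZ, mwpiD) scalerDr.
Qed.
Fact mwscaleDl u : {morph mwscale^~ u : a b / a + b}.
Proof. by move=> a b; rewrite -[u]mwpi_repr -!(mwpiZ, mwpiD) scalerDl. Qed.
HB.instance Definition _ := GRing.Zmodule_isLmodule.Build R[i] MWq
  mwscaleA mwscale1 mwscaleDr mwscaleDl.

Fact mwscaleAl (a : R[i]) (u v : MWq) : a *: (u * v) = a *: u * v.
Proof.
rewrite -[u]mwpi_repr -[v]mwpi_repr.
rewrite -[LHS]/(mwscale a (mwmul _ _)) -[RHS]/(mwmul (mwscale a _) _).
by rewrite -!(mwpiZ, mwpiM) scalerAl.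
Qed.
HB.instance Definition _ := GRing.Lmodule_isLalgebra.Build R[i] MWq mwscaleAl.

Fact mwscaleAr (a : R[i]) (u v : MWq) : a *: (u * v) = u * (a *: v).
Proof.
rewrite -[u]mwpi_repr -[v]mwpi_repr.
rewrite -[LHS]/(mwscale a (mwmul _ _)) -[RHS]/(mwmul _ (mwscale a _)).
by rewrite -!(mwpiZ, mwpiM) scalerAr.
Qed.
HB.instance Definition _ := GRing.Lalgebra_isAlgebra.Build R[i] MWq mwscaleAr.

Definition mwx : MWq := mwpi (fx R).
Definition mwy : MWq := mwpi (fy R).
Definition mwq : MWq := mwpi (fq R).

End MeromorphicWeyl.

Section Endomorphisms.
Variables (K : comNzRingType) (V : lmodType K).

Definition End := {linear V -> V}.

Lemma endP (f g : End) : (f : V -> V) =1 g -> f = g.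
Proof.
case: f g => [f [[fD] [fZ]]] [g [[gD] [gZ]]] /= /funext fg.
case: _ / fg gD gZ => gD gZ.
by rewrite (Prop_irrelevance fD gD) (Prop_irrelevance fZ gZ).
Qed.

HB.instance Definition _ := gen_eqMixin End.
HB.instance Definition _ := gen_choiceMixin End.

Definition end0 : End := (\0 : V -> V).
Definition endN (f : End) : End := (\- f : V -> V).
Definition endD (f g : End) : End := (f \+ g : V -> V).
Definition end1 : End := (idfun : V -> V).
Definition endM (f g : End) : End := (f \o g : V -> V).
Definition endZ (c : K) (f : End) : End := (c \*: f : V -> V).

Fact endDA : associative endD.
Proof. by move=> f g h; apply: endP => v /=; rewrite addrA. Qed.
Fact endDC : commutative endD.
Proof. by move=> f g; apply: endP => v /=; rewrite addrC. Qed.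
Fact end0D : left_id end0 endD.
Proof. by move=> f; apply: endP => v /=; rewrite add0r. Qed.
Fact endND : left_inverse end0 endN endD.
Proof. by move=> f; apply: endP => v /=; rewrite addNr. Qed.
HB.instance Definition _ := GRing.isZmodule.Build End endDA endDC end0D endND.

Fact endMA : associative endM.
Proof. by move=> f g h; apply: endP. Qed.
Fact end1M : left_id end1 endM.
Proof. by move=> f; apply: endP. Qed.
Fact endM1 : right_id end1 endM.
Proof. by move=> f; apply: endP. Qed.
Fact endMDl : left_distributive endM +%R.
Proof. by move=> f g h; apply: endP. Qed.
Fact endMDr : right_distributive endM +%R.
Proof. by move=> f g h; apply: endP => v /=; rewrite raddfD. Qed.
HB.instance Definition _ := GRing.Zmodule_isPzRing.Build End
  endMA end1M endM1 endMDl endMDr.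

Fact endZA a b f : endZ a (endZ b f) = endZ (a * b) f.
Proof. by apply: endP => v /=; rewrite scalerA. Qed.
Fact end1Z : left_id 1 endZ.
Proof. by move=> f; apply: endP => v /=; rewrite scale1r. Qed.
Fact endZDr : right_distributive endZ +%R.
Proof. by move=> a f g; apply: endP => v /=; rewrite scalerDr. Qed.
Fact endZDl f : {morph endZ^~ f : a b / a + b}.
Proof. by move=> a b; apply: endP => v /=; rewrite scalerDl. Qed.
HB.instance Definition _ := GRing.Zmodule_isLmodule.Build K End
  endZA end1Z endZDr endZDl.

Fact endZAl (a : K) (f g : End) : a *: (f * g) = a *: f * g.
Proof. by apply: endP. Qed.
Fact endZAr (a : K) (f g : End) : a *: (f * g) = f * (a *: g).
Proof. by apply: endP => v /=; rewrite linearZ. Qed.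

End Endomorphisms.

Section Functions.
Variable R : realType.

Definition Rstar := {x : R | x != 0}.
Definition MRstar := Rstar -> R[i].
HB.instance Definition _ := GRing.Lmodule.on MRstar.

(* Algebras are non-trivial rings in the library, so the algebra structure on
   endomorphisms is only put on spaces known to be non-zero. *)
Definition EndM := End MRstar.
HB.instance Definition _ := GRing.PzRing.on EndM.
HB.instance Definition _ := GRing.Lmodule.on EndM.

Fact EndM_neq0 : (1 : EndM) != 0.
Proof.
apply/eqP => /(congr1 (fun f : EndM => f (cst 1) (exist _ 1 (oner_neq0 R)))).
by move/eqP; rewrite oner_eq0.
Qed.
HB.instance Definition _ := GRing.PzSemiRing_isNonZero.Build EndM EndM_neq0.
HB.instance Definition _ := GRing.Lmodule_isLalgebra.Build R[i] EndM
  (@endZAl _ MRstar).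
HB.instance Definition _ := GRing.Lalgebra_isAlgebra.Build R[i] EndM
  (@endZAr _ MRstar).

Fact dilate_neq0 (r : R) (x : Rstar) : 0 < r -> r * val x != 0.
Proof. by move=> r0; rewrite mulf_neq0 ?(valP x) // gt_eqF. Qed.
Definition dilate (r : R) (r0 : 0 < r) (x : Rstar) : Rstar :=
  exist _ (r * val x) (dilate_neq0 x r0).

(* The difference operator is meant for r != 1; at r = 1 the convention on
   division by 0 makes it identically 0. *)
Definition jackson (r : R) (r0 : 0 < r) (f : MRstar) : MRstar := fun x =>
  (f (dilate r0 x) - f x) / ((r - 1) * val x)%:C.

Lemma posrV (r : R) : 0 < r -> 0 < r^-1.
Proof. by rewrite invr_gt0. Qed.

End Functions.

(* Main.v *)
Require Import Defs.
From HB Require Import structures.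
From mathcomp Require Import all_boot all_order all_algebra.
From mathcomp Require Import boolp functions reals complex.
From mathcomp Require Import ring.
From mathcomp.multinomials Require Import monalg.
Import Order.TTheory GRing.Theory Num.Theory.
Local Open Scope ring_scope.
Local Open Scope complex_scope.

(** An algebra presented by generators and relations maps to any algebra in
which the images of the generators satisfy the relations.  For [MWq] the
generators are [x], [y] and the central [q], so a choice of images [X], [Y],
[Z] extends to a homomorphism as soon as [Z] commutes with [X] and [Y] and
[Y * X = Z * X * Y + X ^+ 2]; this is [MWq_universal].  It is obtained in three
layers that follow the construction of [MWq]: words in [x] and [y] are sent to
products and extended linearly ([free_eval]), the commuting variable [q] is
evaluated at [Z] as in a polynomial ([Cxyq_eval]), and the result, which kills
the defining relation and hence the two-sided ideal that it generates, is
passed to the quotient ([MWq_eval]).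

What remains is one identity between operators on functions, namely
[y_end_inv_end].  The operator [Z] is the scalar [q], which commutes with
everything.  Write [Y f x = - (f (x / q) - f x) / ((1 - q) * x)].  Then
[Y (X f)] involves [q * f (x / q) - f x] and [q * X (Y f)] involves
[q * f (x / q) - q * f x], both over [- (1 - q) * x ^ 2]; the values at [x / q]
cancel in the difference, leaving [f x / x ^ 2], which is [X (X f) x]. *)

Lemma comm_alg {K : pzRingType} {A : algType K} (a : A) (c : K) :
  GRing.comm a c%:A.
Proof. by rewrite /GRing.comm mulr_algl mulr_algr. Qed.

Section FreeAlgebraEvaluation.
Context {K : comNzRingType} {A : algType K} {I : choiceType} (g : I -> A).

Definition word_eval (m : fmonom I) : A := \prod_(i <- m) g i.

Fact word_eval_mmorphism : mmorphism word_eval.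
Proof. by split=> [m n|]; rewrite /word_eval ?fmM ?big_cat // fm1 big_nil. Qed.
HB.instance Definition _ :=
  isMultiplicative.Build (fmonom I) A word_eval word_eval_mmorphism.

Lemma word_evalU i : word_eval (fmu i) = g i.
Proof. by rewrite /word_eval fmU big_seq1. Qed.

Definition free_eval : {malg K[{fmonom I}]} -> A := mmap (in_alg A) word_eval.
HB.instance Definition _ := GRing.Additive.on free_eval.

(** [A] need not be commutative: it is enough that coefficients, being scalars,
commute with the values of words. *)
Fact free_eval_monoid_morphism : monoid_morphism free_eval.
Proof.
have comm (a : {malg K[{fmonom I}]}) m m' :
  GRing.comm (in_alg A a@_m) (word_eval m') by exact/commr_sym/comm_alg.
by have [M one] := commr_mmap_is_multiplicative comm; split.
Qed.
HB.instance Definition _ :=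
  GRing.isMonoidMorphism.Build {malg K[{fmonom I}]} A free_eval
    free_eval_monoid_morphism.

Lemma free_evalU i : free_eval << fmu i >> = g i.
Proof. by rewrite /free_eval mmapU /= scale1r mul1r word_evalU. Qed.

Lemma free_evalC c : free_eval c%:MP = c%:A.
Proof. exact: mmapC. Qed.

(** This is the condition under which a further commuting variable may be
evaluated at [z]. *)
Lemma free_eval_comm (z : A) :
  (forall i, GRing.comm z (g i)) -> commr_rmorph free_eval z.
Proof.
move=> zg a; rewrite /free_eval mmapE; apply: commr_sum => m _.
apply: commrM; first exact: comm_alg.
by apply: commr_prod => i _.
Qed.

End FreeAlgebraEvaluation.

Section UniversalProperty.
Context {R : realType} {A : algType R[i]} (X Y Z : A).
Hypotheses (ZX : GRing.comm Z X) (ZY : GRing.comm Z Y).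

Definition letter_image (i : 'I_2) : A := if i == ord0 then X else Y.

Fact letter_image_comm : commr_rmorph (free_eval letter_image) Z.
Proof. by apply: free_eval_comm => i; rewrite /letter_image; case: eqP. Qed.

Definition Cxyq_eval : Cxyq R -> A := horner_morph letter_image_comm.
HB.instance Definition _ :=
  GRing.RMorphism.copy Cxyq_eval (horner_morph letter_image_comm).

Fact Cxyq_evalZ : scalable Cxyq_eval.
Proof.
(* A complex scalar acts on Cxyq through the constant polynomials of Cxy,
   whereas linearity of evaluation is over the whole coefficient ring Cxy. *)
move=> c p; rewrite -[c *: p]/((c%:MP : Cxy R) *: (p : {poly Cxy R})).
by rewrite /Cxyq_eval linearZ /= free_evalC mulr_algl.
Qed.
HB.instance Definition _ :=
  GRing.isScalable.Build R[i] (Cxyq R) A *:%R Cxyq_eval Cxyq_evalZ.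

Lemma Cxyq_eval_letter i : Cxyq_eval (letter R i) = letter_image i.
Proof.
rewrite letter.unlock /Cxyq_eval horner_morphC; exact: free_evalU.
Qed.

Lemma Cxyq_eval_fx : Cxyq_eval (fx R) = X.
Proof. exact: Cxyq_eval_letter. Qed.

Lemma Cxyq_eval_fy : Cxyq_eval (fy R) = Y.
Proof. exact: Cxyq_eval_letter. Qed.

Lemma Cxyq_eval_fq : Cxyq_eval (fq R) = Z.
Proof. by rewrite fq.unlock /Cxyq_eval horner_morphX. Qed.

Hypothesis YX : Y * X = Z * X * Y + X ^+ 2.

Lemma Cxyq_eval_mwrel : Cxyq_eval (mwrel R) = 0.
Proof.
rewrite /mwrel !rmorphB rmorphXn !rmorphM /= Cxyq_eval_fx Cxyq_eval_fy.
by rewrite Cxyq_eval_fq YX [_ + X ^+ 2]addrC addrK subrr.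
Qed.

Lemma Cxyq_eval_mwideal p : p \in @mwideal R -> Cxyq_eval p = 0.
Proof.
move=> /asboolP[s ->]; rewrite rmorph_sum big1 // => u _.
by rewrite !rmorphM /= Cxyq_eval_mwrel mulr0 mul0r.
Qed.

Definition MWq_eval (u : MWq R) : A := Cxyq_eval (repr u).

(** Independence of the representative: all algebraic properties of [MWq_eval]
below are transported from [Cxyq_eval] along this equation. *)
Lemma MWq_eval_mwpi p : MWq_eval (mwpi p) = Cxyq_eval p.
Proof.
apply/eqP; rewrite /MWq_eval -subr_eq0 -rmorphB; apply/eqP.
by apply: Cxyq_eval_mwideal; apply/mwpiE; rewrite mwpi_repr.
Qed.

Fact MWq_evalB : {morph MWq_eval : u v / u - v}.
Proof.
move=> u v; rewrite -[u]mwpi_repr -[v]mwpi_repr.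
rewrite -scaleN1r -[-1 *: _]/(mwscale _ _) -mwpiZ -mwpiD !MWq_eval_mwpi.
by rewrite rmorphD /= linearZ /= scaleN1r.
Qed.
HB.instance Definition _ :=
  GRing.isZmodMorphism.Build (MWq R) A MWq_eval MWq_evalB.

Fact MWq_eval_monoid_morphism : monoid_morphism MWq_eval.
Proof.
split=> [|u v]; first by rewrite -[1]/(mwpi 1) MWq_eval_mwpi rmorph1.
rewrite -[u]mwpi_repr -[v]mwpi_repr -[_ * _]/(mwmul _ _) -mwpiM.
by rewrite !MWq_eval_mwpi rmorphM.
Qed.
HB.instance Definition _ :=
  GRing.isMonoidMorphism.Build (MWq R) A MWq_eval MWq_eval_monoid_morphism.

Fact MWq_evalZ : scalable MWq_eval.
Proof.
move=> c u; rewrite -[u]mwpi_repr -[c *: _]/(mwscale _ _) -mwpiZ.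
by rewrite !MWq_eval_mwpi linearZ.
Qed.
HB.instance Definition _ :=
  GRing.isScalable.Build R[i] (MWq R) A *:%R MWq_eval MWq_evalZ.

(** The existence half of the universal property of the presentation of
[MWq]. *)
Lemma MWq_universal : exists rho : {lrmorphism MWq R -> A},
  [/\ rho (mwx R) = X, rho (mwy R) = Y & rho (mwq R) = Z].
Proof.
exists MWq_eval; split; rewrite /= MWq_eval_mwpi.
- exact: Cxyq_eval_fx.
- exact: Cxyq_eval_fy.
- exact: Cxyq_eval_fq.
Qed.

End UniversalProperty.

Section Operators.
Context {R : realType}.

Definition inv_op (f : MRstar R) : MRstar R :=
  fun x => ((val x)^-1)%:C * f x.

Fact inv_op_linear : linear inv_op.
Proof.
by move=> c f g; apply/funext => x; rewrite /inv_op mulrDr [in RHS]/= mulrCA.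
Qed.
HB.instance Definition _ :=
  GRing.isLinear.Build R[i] (MRstar R) (MRstar R) *:%R inv_op inv_op_linear.

Fact jackson_linear (r : R) (r0 : 0 < r) : linear (jackson r0).
Proof.
move=> c f g; apply/funext => x; rewrite /jackson opprD addrACA mulrDl.
by rewrite -mulrBr -mulrA.
Qed.
HB.instance Definition _ (r : R) (r0 : 0 < r) :=
  GRing.isLinear.Build R[i] (MRstar R) (MRstar R) *:%R (jackson r0)
    (jackson_linear r r0).

Definition inv_end : EndM R := (inv_op : {linear _ -> _}).

Definition jackson_end {r : R} (r0 : 0 < r) : EndM R :=
  (jackson r0 : {linear _ -> _}).

Definition y_end {q : R} (q_gt0 : 0 < q) : EndM R :=
  - (q^-1)%:C *: jackson_end (posrV q_gt0).

(** Evaluated on [f] at [x], both sides are rational expressions in [q], [x],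
[f x] and [f (x / q)], so after the substitution the relation is a field
identity; its denominators are [q], [x] and [1 - q]. *)
Lemma y_end_inv_end {q : R} (q_gt0 : 0 < q) : q != 1 ->
  y_end q_gt0 * inv_end =
    (q%:C)%:A * inv_end * y_end q_gt0 + inv_end ^+ 2.
Proof.
move=> q_neq1; rewrite mulr_algl -scalerAl expr2.
apply: endP => f; apply/funext => x.
have q_neq0 : q%:C != 0 by rewrite fmorph_eq0 gt_eqF.
have x_neq0 : (val x)%:C != 0 by rewrite fmorph_eq0 (valP x).
have subq_neq0 : 1 - q%:C != 0.
  by rewrite -(rmorph1 (real_complex R)) -rmorphB fmorph_eq0 subr_eq0 eq_sym.
pose qx := dilate (posrV q_gt0) x.
rewrite -[LHS]/(- (q^-1)%:C *
  (((q^-1 * val x)^-1%:C * f qx - (val x)^-1%:C * f x)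
    / ((q^-1 - 1) * val x)%:C)).
rewrite -[RHS]/(
  q%:C * ((val x)^-1%:C *
    (- (q^-1)%:C * ((f qx - f x) / ((q^-1 - 1) * val x)%:C)))
  + (val x)^-1%:C * ((val x)^-1%:C * f x)).
rewrite !(fmorphV, rmorphM, rmorphB, rmorph1) /=.
move: (f qx) (f x) (q%:C) ((val x)%:C) q_neq0 x_neq0 subq_neq0.
move=> b a u v u_neq0 v_neq0 subu_neq0; field.
by rewrite u_neq0 v_neq0 mulN1r.
Qed.

End Operators.

Theorem theorem5 (R : realType) (q : R) (q_gt0 : 0 < q) (q_lt1 : q < 1) :
  exists rho : {lrmorphism MWq R -> EndM R},
    forall f : MRstar R,
      [/\ rho (mwx R) f = (fun x : Rstar R => ((val x)^-1)%:C * f x),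
          rho (mwy R) f = - (q^-1)%:C *: jackson (posrV q_gt0) f
        & rho (mwq R) f = q%:C *: f].
Proof.
have comm g : GRing.comm ((q%:C)%:A : EndM R) g.
  exact/commr_sym/comm_alg.
have q_neq1 : q != 1 by rewrite lt_eqF.
have [rho [rx ry rq]] :=
  MWq_universal _ _ _ (comm _) (comm _) (y_end_inv_end q_gt0 q_neq1).
by exists rho => f; rewrite rx ry rq.
Qed.
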